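(* Let $(A,\cdot,[\cdot,\cdot],\alpha)$ be a Hom-$F$-manifold algebra. There is a Hom-pre-$F$-manifold algebra structure $(A,\diamond,\ast,\alpha)$ on $A$ whose sub-adjacent Hom-$F$-manifold algebra is exactly $(A,\cdot,[\cdot,\cdot],\alpha)$ if and only if there exists an invertible $\mathcal O$-operator $T:V\to A$ on $(A,\cdot,[\cdot,\cdot],\alpha)$ with respect to some representation $(V;\rho,\mu,\phi)$ of $A$.
   Context: All vector spaces are over an algebraically closed field $\mathbb K$ of characteristic $0$. Twist maps are linear and multiplicative for all operations under consideration (e.g. $\alpha(x\cdot y)=\alpha(x)\cdot\alpha(y)$, $\alpha([x,y])=[\alpha(x),\alpha(y)]$ in a Hom-$F$-manifold algebra; $\alpha(x\diamond y)=\alpha(x)\diamond\alpha(y)$, $\alpha(x\ast y)=\alpha(x)\ast\alpha(y)$ in a Hom-pre-$F$-manifold algebra). A Hom-$F$-manifold algebra is a tuple $(A,\cdot,[\cdot,\cdot],\alpha)$ such that: $\cdot$ is bilinear, commutative and $\alpha(x)\cdot(y\cdot z)=(x\cdot y)\cdot\alpha(z)$; $[\cdot,\cdot]$ is bilinear, skew-symmetric and $[\alpha(x),[y,z]]+[\alpha(y),[z,x]]+[\alpha(z),[x,y]]=0$; and $\mathcal L(x\cdot y,\alpha(z),\alpha(w))=\alpha^2(x)\cdot\mathcal L(y,z,w)+\alpha^2(y)\cdot\mathcal L(x,z,w)$, where $\mathcal L(x,y,z)=[\alpha(x),y\cdot z]-[x,y]\cdot\alpha(z)-\alpha(y)\cdot[x,z]$.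 A representation of a Hom-$F$-manifold algebra $A$ is $(V;\rho,\mu,\phi)$ with $\rho,\mu:A\to\mathfrak{gl}(V)$ linear and $\phi\in\mathfrak{gl}(V)$ such that: $\mu(\alpha(x))\phi=\phi\mu(x)$, $\mu(x\cdot y)\phi=\mu(\alpha(x))\mu(y)$; $\rho(\alpha(x))\phi=\phi\rho(x)$, $\rho([x,y])\phi=\rho(\alpha(x))\rho(y)-\rho(\alpha(y))\rho(x)$; and for all $x,y,z\in A$, $u\in V$ $$\mathcal L_1(x\cdot y,\alpha(z),\phi(u))=\mu(\alpha^2(x))\mathcal L_1(y,z,u)+\mu(\alpha^2(y))\mathcal L_1(x,z,u),$$ $$\mu(\mathcal L(x,y,z))\phi^2(u)=\mathcal L_2(\alpha(y),\alpha(z),\mu(x)(u))-\mu(\alpha^2(x))\mathcal L_2(y,z,u),$$ where $\mathcal L_1(x,y,u)=\rho(\alpha(x))\mu(y)(u)-\mu(\alpha(y))\rho(x)(u)-\mu([x,y])\phi(u)$ and $\mathcal L_2(x,y,u)=\mu(\alpha(x))\rho(y)(u)+\mu(\alpha(y))\rho(x)(u)-\rho(x\cdot y)\phi(u)$. An $\mathcal O$-operator on $A$ with respect to $(V;\rho,\mu,\phi)$ is a linear map $T:V\to A$ with $T\phi=\alpha T$, $T(u)\cdot T(v)=T(\mu(T(u))v+\mu(T(v))u)$ and $[T(u),T(v)]=T(\rho(T(u))v-\rho(T(v))u)$ for all $u,v\in V$. A Hom-pre-$F$-manifold algebra is a tuple $(A,\diamond,\ast,\alpha)$ such that: $\diamond$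 is bilinear with $\alpha(x)\diamond(y\diamond z)=(y\diamond x)\diamond\alpha(z)+(x\diamond y)\diamond\alpha(z)$; $\ast$ is bilinear with $(x\ast y)\ast\alpha(z)-\alpha(x)\ast(y\ast z)=(y\ast x)\ast\alpha(z)-\alpha(y)\ast(x\ast z)$; and, with $x\cdot y=x\diamond y+y\diamond x$, $[x,y]=x\ast y-y\ast x$, $$F_1(x\cdot y,\alpha(z),\alpha(w))=\alpha^2(x)\diamond F_1(y,z,w)+\alpha^2(y)\diamond F_1(x,z,w),$$ $$\mathcal L(x,y,z)\diamond\alpha^2(w)=F_2(\alpha(y),\alpha(z),x\diamond w)-\alpha^2(x)\diamond F_2(y,z,w),$$ where $F_1(x,y,z)=\alpha(x)\ast(y\diamond z)-\alpha(y)\diamond(x\ast z)-[x,y]\diamond\alpha(z)$, $F_2(x,y,z)=\alpha(x)\diamond(y\ast z)+\alpha(y)\diamond(x\ast z)-(x\cdot y)\ast\alpha(z)$, and $\mathcal L(x,y,z)=[\alpha(x),y\cdot z]-[x,y]\cdot\alpha(z)-\alpha(y)\cdot[x,z]$. Its sub-adjacent Hom-$F$-manifold algebra is $(A,\cdot,[\cdot,\cdot],\alpha)$ with $x\cdot y=x\diamond y+y\diamond x$ and $[x,y]=x\ast y-y\ast x$. *)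

(* Defs.v *)
From HB Require Import structures.
From mathcomp Require Import all_boot all_order all_algebra.
From mathcomp Require Import sesquilinear.

Set Implicit Arguments.
Unset Strict Implicit.
Unset Printing Implicit Defensive.

Import GRing.Theory.
Local Open Scope ring_scope.

Definition hom_leibnizator (K : fieldType) (A : lmodType K)
    (mul br : A -> A -> A) (alpha : A -> A) (x y z : A) : A :=
  br (alpha x) (mul y z) - mul (br x y) (alpha z) - mul (alpha y) (br x z).

Record hom_F_manifold (K : fieldType) (A : lmodType K)
    (mul br : {bilinear A -> A -> A}) (alpha : {linear A -> A}) : Prop :=
  HomFManifold {
    hFm_alpha_mul : forall x y, alpha (mul x y) = mul (alpha x) (alpha y);
    hFm_alpha_br : forall x y, alpha (br x y) = br (alpha x) (alpha y);
    hFm_mulC : forall x y, mul x y = mul y x;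
    hFm_mulA : forall x y z,
      mul (alpha x) (mul y z) = mul (mul x y) (alpha z);
    hFm_brN : forall x y, br x y = - br y x;
    hFm_jacobi : forall x y z,
      br (alpha x) (br y z) + br (alpha y) (br z x) + br (alpha z) (br x y)
      = 0;
    hFm_hertling_manin : forall x y z w,
      let L := hom_leibnizator mul br alpha in
      L (mul x y) (alpha z) (alpha w)
      = mul (alpha (alpha x)) (L y z w) + mul (alpha (alpha y)) (L x z w)
  }.

Definition rep_L1 (K : fieldType) (A V : lmodType K)
    (br : A -> A -> A) (alpha : A -> A) (rho mu : A -> V -> V) (phi : V -> V)
    (x y : A) (u : V) : V :=
  rho (alpha x) (mu y u) - mu (alpha y) (rho x u) - mu (br x y) (phi u).

Definition rep_L2 (K : fieldType) (A V : lmodType K)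
    (mul : A -> A -> A) (alpha : A -> A) (rho mu : A -> V -> V) (phi : V -> V)
    (x y : A) (u : V) : V :=
  mu (alpha x) (rho y u) + mu (alpha y) (rho x u) - rho (mul x y) (phi u).

(* A linear map A -> gl(V) is given in uncurried form, as a bilinear map
   A -> V -> V. *)
Record hom_F_manifold_rep (K : fieldType) (A V : lmodType K)
    (mul br : {bilinear A -> A -> A}) (alpha : {linear A -> A})
    (rho mu : {bilinear A -> V -> V}) (phi : {linear V -> V}) : Prop :=
  HomFManifoldRep {
    rep_mu_phi : forall x u, mu (alpha x) (phi u) = phi (mu x u);
    rep_mu_mul : forall x y u,
      mu (mul x y) (phi u) = mu (alpha x) (mu y u);
    rep_rho_phi : forall x u, rho (alpha x) (phi u) = phi (rho x u);
    rep_rho_br : forall x y u,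
      rho (br x y) (phi u)
      = rho (alpha x) (rho y u) - rho (alpha y) (rho x u);
    rep_L1_mul : forall x y z u,
      let L1 := rep_L1 br alpha rho mu phi in
      L1 (mul x y) (alpha z) (phi u)
      = mu (alpha (alpha x)) (L1 y z u) + mu (alpha (alpha y)) (L1 x z u);
    rep_L2_mu : forall x y z u,
      let L := hom_leibnizator mul br alpha in
      let L2 := rep_L2 mul alpha rho mu phi in
      mu (L x y z) (phi (phi u))
      = L2 (alpha y) (alpha z) (mu x u) - mu (alpha (alpha x)) (L2 y z u)
  }.

Record O_operator (K : fieldType) (A V : lmodType K)
    (mul br : {bilinear A -> A -> A}) (alpha : {linear A -> A})
    (rho mu : {bilinear A -> V -> V}) (phi : {linear V -> V})
    (T : {linear V -> A}) : Prop :=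
  OOperator {
    Oop_phi : forall u, T (phi u) = alpha (T u);
    Oop_mul : forall u v, mul (T u) (T v) = T (mu (T u) v + mu (T v) u);
    Oop_br : forall u v, br (T u) (T v) = T (rho (T u) v - rho (T v) u)
  }.

Definition subadj_mul (K : fieldType) (A : lmodType K)
  (dia : A -> A -> A) (x y : A) : A := dia x y + dia y x.

Definition subadj_br (K : fieldType) (A : lmodType K)
  (ast : A -> A -> A) (x y : A) : A := ast x y - ast y x.

Definition pre_F1 (K : fieldType) (A : lmodType K)
    (dia ast : A -> A -> A) (alpha : A -> A) (x y z : A) : A :=
  ast (alpha x) (dia y z) - dia (alpha y) (ast x z)
  - dia (subadj_br ast x y) (alpha z).

Definition pre_F2 (K : fieldType) (A : lmodType K)
    (dia ast : A -> A -> A) (alpha : A -> A) (x y z : A) : A :=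
  dia (alpha x) (ast y z) + dia (alpha y) (ast x z)
  - ast (subadj_mul dia x y) (alpha z).

Record hom_pre_F_manifold (K : fieldType) (A : lmodType K)
    (dia ast : {bilinear A -> A -> A}) (alpha : {linear A -> A}) : Prop :=
  HomPreFManifold {
    hpFm_alpha_dia : forall x y, alpha (dia x y) = dia (alpha x) (alpha y);
    hpFm_alpha_ast : forall x y, alpha (ast x y) = ast (alpha x) (alpha y);
    hpFm_zinbiel : forall x y z,
      dia (alpha x) (dia y z)
      = dia (dia y x) (alpha z) + dia (dia x y) (alpha z);
    hpFm_prelie : forall x y z,
      ast (ast x y) (alpha z) - ast (alpha x) (ast y z)
      = ast (ast y x) (alpha z) - ast (alpha y) (ast x z);
    hpFm_F1 : forall x y z w,
      let F1 := pre_F1 dia ast alpha in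
      F1 (subadj_mul dia x y) (alpha z) (alpha w)
      = dia (alpha (alpha x)) (F1 y z w) + dia (alpha (alpha y)) (F1 x z w);
    hpFm_F2 : forall x y z w,
      let L := hom_leibnizator (subadj_mul dia) (subadj_br ast) alpha in
      let F2 := pre_F2 dia ast alpha in
      dia (L x y z) (alpha (alpha w))
      = F2 (alpha y) (alpha z) (dia x w) - dia (alpha (alpha x)) (F2 y z w)
  }.

(* Main.v *)
Require Import Defs.
From HB Require Import structures.
From mathcomp Require Import all_boot all_order all_algebra.
From mathcomp Require Import sesquilinear.

Import GRing.Theory.
Local Open Scope ring_scope.

(** The two products of a Hom-pre-F-manifold algebra are themselves a
    representation (rho = ast, mu = dia, phi = alpha) of the sub-adjacent algebra
    on A, for which the identity is an O-operator.  Conversely, an invertible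
    O-operator T lets one carry the representation over to A, by
    dia x y = T (mu x (T^-1 y)) and ast x y = T (rho x (T^-1 y)); the O-operator
    equations then say that the sub-adjacent operations are the given ones, and
    each pre-F-manifold axiom is the T-image of a representation axiom. *)

(** Passes between the pre-Lie axiom, an equality of two associators, and the representation axiom
    for [rho] on a commutator. *)
Lemma subr_eq_subC (V : zmodType) (a b c d : V) :
  (a - b == c - d) = (a - c == b - d).
Proof. by rewrite subr_eq -addrA [- d + b]addrC addrC -subr_eq. Qed.

Definition transport {K : fieldType} {A V : lmodType K} (T : V -> A)
    (S : A -> V) (f : A -> V -> V) (x y : A) : A := T (f x (S y)).

Lemma transport_bilinear {K : fieldType} {A V : lmodType K}
    (T : {linear V -> A}) (S : {linear A -> V}) (f : {bilinear A -> V -> V}) :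
  bilinear_for *:%R *:%R (transport T S f).
Proof.
split=> z a x y; rewrite /transport; first by rewrite linearPl linearP.
by rewrite linearP linearPr linearP.
Qed.

HB.instance Definition _ (K : fieldType) (A V : lmodType K)
    (T : {linear V -> A}) (S : {linear A -> V}) (f : {bilinear A -> V -> V}) :=
  bilinear_isBilinear.Build K A A A *:%R *:%R (transport T S f)
    (transport_bilinear T S f).

Lemma rep_of_hom_pre_F_manifold {K : fieldType} {A : lmodType K}
    (mul br dia ast : {bilinear A -> A -> A}) (alpha : {linear A -> A}) :
    hom_pre_F_manifold dia ast alpha ->
    (forall x y, subadj_mul dia x y = mul x y) ->
    (forall x y, subadj_br ast x y = br x y) ->
  hom_F_manifold_rep mul br alpha ast dia alpha.
Proof.
move=> [adia aast zinb prel F1E F2E] mulE brE.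
(* With [rho = ast], [mu = dia] and [phi = alpha], L1 and F1 differ only in the name of the bracket,
   as L2 and F2 do in that of the product. *)
have L1E x y u : rep_L1 br alpha ast dia alpha x y u = pre_F1 dia ast alpha x y u.
  by rewrite /rep_L1 -brE.
have L2E x y u : rep_L2 mul alpha ast dia alpha x y u = pre_F2 dia ast alpha x y u.
  by rewrite /rep_L2 -mulE.
have LE x y z : hom_leibnizator mul br alpha x y z
    = hom_leibnizator (subadj_mul dia) (subadj_br ast) alpha x y z.
  by rewrite /hom_leibnizator -!mulE -!brE.
split=> /=.
- by move=> x u; rewrite adia.
- by move=> x y u; rewrite -mulE /subadj_mul linearDl zinb addrC.
- by move=> x u; rewrite aast.
- move=> x y u; rewrite -brE linearBl.
  by apply/eqP; rewrite subr_eq_subC prel.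
- by move=> x y z u; rewrite !L1E -mulE F1E.
- by move=> x y z u; rewrite !L2E LE F2E.
Qed.

Lemma hom_pre_F_manifold_transport {K : fieldType} {A V : lmodType K}
    {mul br : {bilinear A -> A -> A}} {alpha : {linear A -> A}}
    {rho mu : {bilinear A -> V -> V}} {phi : {linear V -> V}}
    {T : {linear V -> A}} {S : {linear A -> V}} :
    hom_F_manifold_rep mul br alpha rho mu phi ->
    O_operator mul br alpha rho mu phi T -> cancel T S -> cancel S T ->
  [/\ hom_pre_F_manifold (transport T S mu) (transport T S rho) alpha,
      forall x y, subadj_mul (transport T S mu) x y = mul x y
    & forall x y, subadj_br (transport T S rho) x y = br x y].
Proof.
move=> [muphi mumul rhophi rhobr L1mul L2mu] [Tphi Tmul Tbr] TK SK.
have Salpha x : S (alpha x) = phi (S x) by rewrite -{1}(SK x) -Tphi TK.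
have mulE x y : subadj_mul (transport T S mu) x y = mul x y.
  (* Writing x = T (S x) and y = T (S y) puts the product in the form covered by the O-operator
     equation. *)
  by rewrite -{2}(SK x) -{2}(SK y) Tmul !SK linearD.
have brE x y : subadj_br (transport T S rho) x y = br x y.
  by rewrite -{2}(SK x) -{2}(SK y) Tbr !SK linearB.
(* In nested transported products the inner [S] cancels the inner [T], so only the [S] on the last
   argument and the outermost [T] survive. *)
have F1E x y z : pre_F1 (transport T S mu) (transport T S rho) alpha x y z
    = T (rep_L1 br alpha rho mu phi x y (S z)).
  by rewrite /pre_F1 brE /rep_L1 /transport !TK Salpha !linearB.
have F2E x y z : pre_F2 (transport T S mu) (transport T S rho) alpha x y z
    = T (rep_L2 mul alpha rho mu phi x y (S z)).
  by rewrite /pre_F2 mulE /rep_L2 /transport !TK Salpha linearB linearD.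
have LE x y z : hom_leibnizator (subadj_mul (transport T S mu))
      (subadj_br (transport T S rho)) alpha x y z
    = hom_leibnizator mul br alpha x y z.
  by rewrite /hom_leibnizator !mulE !brE.
split=> //; split=> /=.
- by move=> x y; rewrite /transport -Tphi -muphi Salpha.
- by move=> x y; rewrite /transport -Tphi -rhophi Salpha.
(* The right-hand side collapses to (x · y) ◇ α(z), so the axiom becomes the T-image of [mumul] at S
   z. *)
- move=> x y z; rewrite addrC -linearDl.
  by rewrite -/(subadj_mul _ x y) mulE /= /transport TK -mumul Salpha.
- move=> x y z; apply/eqP; rewrite subr_eq_subC -linearBl.
  rewrite -/(subadj_br (transport T S rho) x y) brE /=.
  by rewrite /transport !TK Salpha rhobr linearB.
- move=> x y z w; rewrite !F1E mulE !Salpha L1mul linearD.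
  by rewrite /transport !TK.
- by move=> x y z w; rewrite LE !F2E /transport !TK !Salpha L2mu linearB.
Qed.

Theorem proposition4p23 (K : closedFieldType) (charK0 : [pchar K] =i pred0)
    (A : lmodType K) (mul br : {bilinear A -> A -> A})
    (alpha : {linear A -> A}) (HA : hom_F_manifold mul br alpha) :
  (exists dia ast : {bilinear A -> A -> A},
      [/\ hom_pre_F_manifold dia ast alpha,
          (forall x y : A, subadj_mul dia x y = mul x y)
        & (forall x y : A, subadj_br ast x y = br x y)])
  <->
  (exists (V : lmodType K) (rho mu : {bilinear A -> V -> V})
          (phi : {linear V -> V}) (T : {linear V -> A}),
      [/\ hom_F_manifold_rep mul br alpha rho mu phi,
          O_operator mul br alpha rho mu phi T
        & bijective T]).
Proof.
split=> [[dia [ast [pre mulE brE]]]|[V [rho [mu [phi [T [rep op [S TK SK]]]]]]]].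
  exists A, ast, dia, alpha, idfun; split; last by exists id.
    exact: rep_of_hom_pre_F_manifold.
  by split=> //= u v; rewrite -?mulE -?brE.
(* Bijectivity supplies [S] only as a function; as the inverse of a linear map it is linear, which
   makes the transported products bilinear. *)
pose Slin := GRing.isLinear.Build K A V *:%R S (can2_linear TK SK).
pose S' : {linear A -> V} := HB.pack S Slin.
exists (transport T S' mu), (transport T S' rho).
exact: (hom_pre_F_manifold_transport (S := S') rep op TK SK).
Qed.
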